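(* Let $(A_i,B_i)$, $i=1,\dots,n$, be a Majorana string of linear operators on a complex vector space. Then the product operators $M_i=A_iB_i$ ($i=1,\dots,n$) define an extraspecial $2$-group, i.e. $$M_i^2=-1\ \text{ for all } i,\qquad M_iM_{i+1}=-M_{i+1}M_i\ \text{ for } 1\le i\le n-1,\qquad M_iM_j=M_jM_i\ \text{ when } |i-j|\ge 2,$$ and hence the operators $\sigma_i=(1+M_i)/\sqrt{2}$ for $i=1,\dots,n-1$ give a representation of the Artin braid group $B_n$ (that is, each $\sigma_i$ is invertible and $s_i\mapsto\sigma_i$ extends to a group homomorphism from $B_n$).
   Context: A list of pairs of operators $(A_i,B_i)$, $i=1,\dots,n$, is called a Majorana string (a string of Majorana operators) if the following identities hold for all indices for which they make sense: $$A_i^2=B_i^2=1,\qquad A_iB_i=-B_iA_i,\qquad A_iB_{i+1}=-B_{i+1}A_i,\qquad A_{i+1}B_i=B_iA_{i+1},$$ $$A_iB_j=B_jA_i\ \text{ for } |i-j|>1,\qquad A_iA_j=A_jA_i\ \text{ and }\ B_iB_j=B_jB_i\ \text{ for all } i,j .$$ Here $1$ is the identity operator. In the paper, operators $M_i$ ''define an extraspecial $2$-group'' when they satisfy the three relations displayed in the claim. The Artin braid group $B_n$ is the group with generators $s_1,\dots,s_{n-1}$ and relations $s_is_j=s_js_i$ for $|i-j|>1$ and $s_is_{i+1}s_i=s_{i+1}s_is_{i+1}$ for $i=1,\dots,n-2$. *)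

(* Defs.v *)
From HB Require Import structures.
From mathcomp Require Import all_boot all_order all_algebra.
From mathcomp Require Import generic_quotient boolp complex.

Set Implicit Arguments.
Unset Strict Implicit.
Unset Printing Implicit Defensive.

Import GRing.Theory.

Local Open Scope ring_scope.

(* The pairs are indexed by 'I_n, i.e. the indices 1, ..., n are shifted to
   0, ..., n - 1. *)
Definition majorana_string (C : nzRingType) (V : lmodType C) (n : nat)
    (A B : 'I_n -> {linear V -> V}) : Prop :=
  (forall i, A i \o A i =1 idfun) /\
  (forall i, B i \o B i =1 idfun) /\
  (forall i, A i \o B i =1 \- (B i \o A i)) /\
  (forall i j : 'I_n, j = i.+1 :> nat -> A i \o B j =1 \- (B j \o A i)) /\
  (forall i j : 'I_n, j = i.+1 :> nat -> A j \o B i =1 B i \o A j) /\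
  (forall i j : 'I_n, (1 < `|i - j|)%N -> A i \o B j =1 B j \o A i) /\
  (forall i j, A i \o A j =1 A j \o A i) /\
  (forall i j, B i \o B j =1 B j \o B i).

Definition extraspecial_2group (C : nzRingType) (V : lmodType C) (n : nat)
    (M : 'I_n -> {linear V -> V}) : Prop :=
  (forall i, M i \o M i =1 \- idfun) /\
  (forall i j : 'I_n, j = i.+1 :> nat -> M i \o M j =1 \- (M j \o M i)) /\
  (forall i j : 'I_n, (2 <= `|i - j|)%N -> M i \o M j =1 M j \o M i).

(* Words in the letters s_i, encoded as (i, true), and s_i^-1, encoded as
   (i, false). *)
Definition braid_word (n : nat) := seq ('I_n.-1 * bool).

(* The congruence on words generated by free reduction and the braid
   relations; the braid group is the quotient. *)
Inductive braid_cong (n : nat) : braid_word n -> braid_word n -> Prop :=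
| BraidRefl u : braid_cong u u
| BraidSym u v : braid_cong u v -> braid_cong v u
| BraidTrans u v w : braid_cong u v -> braid_cong v w -> braid_cong u w
| BraidCat u u' v v' :
    braid_cong u u' -> braid_cong v v' -> braid_cong (u ++ v) (u' ++ v')
| BraidCancel i b : braid_cong [:: (i, b); (i, ~~ b)] [::]
| BraidComm (i j : 'I_n.-1) : (1 < `|i - j|)%N ->
    braid_cong [:: (i, true); (j, true)] [:: (j, true); (i, true)]
| BraidBraid (i j : 'I_n.-1) : j = i.+1 :> nat ->
    braid_cong [:: (i, true); (j, true); (i, true)]
               [:: (j, true); (i, true); (j, true)].

Definition braid_congb (n : nat) : rel (braid_word n) :=
  fun u v => `[< braid_cong u v >].

Lemma braid_congb_equiv (n : nat) : equiv_class_of (@braid_congb n).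
Proof.
split.
- by move=> u; apply/asboolP; exact: BraidRefl.
- by move=> u v; apply/asboolP/asboolP => /BraidSym.
- move=> v u w /asboolP uv /asboolP vw; apply/asboolP.
  exact: BraidTrans uv vw.
Qed.

Canonical braid_equiv (n : nat) := EquivRelPack (braid_congb_equiv n).

Definition braid_group (n : nat) := {eq_quot (braid_equiv n)}%qT.

HB.instance Definition _ (n : nat) := Choice.on (braid_group n).
HB.instance Definition _ (n : nat) := EqQuotient.on (braid_group n).

Section BraidGroup.
Local Open Scope quotient_scope.
Variable n : nat.
Implicit Types (u v : braid_word n) (x y z : braid_group n).

Definition braid_winv u : braid_word n := rev [seq (l.1, ~~ l.2) | l <- u].
Definition braid_class u : braid_group n := \pi_(braid_group n) u.

Definition braid_one := braid_class [::].
Definition braid_mul x y := braid_class (repr x ++ repr y).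
Definition braid_inv x := braid_class (braid_winv (repr x)).

Lemma braid_classP u v : braid_class u = braid_class v <-> braid_cong u v.
Proof.
rewrite /braid_class; split=> [/eqmodP/asboolP //|uv].
by apply/eqmodP/asboolP.
Qed.

Lemma braid_reprK x : braid_class (repr x) = x.
Proof. exact: reprK. Qed.

Lemma braid_repr_class u : braid_cong (repr (braid_class u)) u.
Proof. by apply/braid_classP; rewrite braid_reprK. Qed.

Lemma braid_winv_cat u v : braid_winv (u ++ v) = braid_winv v ++ braid_winv u.
Proof. by rewrite /braid_winv map_cat rev_cat. Qed.

Lemma braid_winvK : involutive braid_winv.
Proof.
move=> u; rewrite /braid_winv map_rev revK -map_comp.
by rewrite -[RHS]map_id; apply: eq_map => -[i b] /=; rewrite negbK.
Qed.

Lemma braid_mulwV u : braid_cong (u ++ braid_winv u) [::].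
Proof.
elim: u => [|[i b] u IHu]; first exact: BraidRefl.
rewrite -cat1s braid_winv_cat catA -(catA [:: _]) -[[::]]/([::] ++ [::]).
apply: (@BraidTrans _ _ ([:: (i, b)] ++ [:: (i, ~~ b)])).
  apply: BraidCat; last exact: BraidRefl.
  by rewrite -[X in braid_cong _ X]cats0; apply: BraidCat IHu; exact: BraidRefl.
exact: BraidCancel.
Qed.

Lemma braid_mulVw u : braid_cong (braid_winv u ++ u) [::].
Proof. by rewrite -{2}(braid_winvK u); exact: braid_mulwV. Qed.

Lemma braid_class_mul u v :
  braid_mul (braid_class u) (braid_class v) = braid_class (u ++ v).
Proof. by apply/braid_classP; apply: BraidCat; exact: braid_repr_class. Qed.

Lemma braid_mulA : associative braid_mul.
Proof.
move=> x y z; rewrite -[x]braid_reprK -[y]braid_reprK -[z]braid_reprK.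
by rewrite !braid_class_mul catA.
Qed.

Lemma braid_mul1 : left_id braid_one braid_mul.
Proof. by move=> x; rewrite -[x]braid_reprK braid_class_mul. Qed.

Lemma braid_mulr1 : right_id braid_one braid_mul.
Proof. by move=> x; rewrite -[x]braid_reprK braid_class_mul cats0. Qed.

Lemma braid_mulV : left_inverse braid_one braid_inv braid_mul.
Proof.
move=> x; rewrite -{2}[x]braid_reprK braid_class_mul.
by apply/braid_classP; exact: braid_mulVw.
Qed.

Lemma braid_mulrV : right_inverse braid_one braid_inv braid_mul.
Proof.
move=> x; rewrite -{1}[x]braid_reprK braid_class_mul.
by apply/braid_classP; exact: braid_mulwV.
Qed.

HB.instance Definition _ := isGroup.Build (braid_group n)
  braid_mulA braid_mul1 braid_mulr1 braid_mulV braid_mulrV.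

Definition braid_gen (i : 'I_n.-1) : braid_group n := braid_class [:: (i, true)].

End BraidGroup.

Definition group_representation (C : nzRingType) (V : lmodType C)
    (G : groupType) (rho : G -> {linear V -> V}) : Prop :=
  [/\ forall g, bijective (rho g),
      rho 1%g =1 idfun
    & forall g h, rho (g * h)%g =1 rho g \o rho h].

(* Main.v *)
Require Import Defs.
From mathcomp Require Import all_boot all_order all_algebra.
From mathcomp Require Import reals complex.
From mathcomp Require Import generic_quotient.

Set Implicit Arguments.
Unset Strict Implicit.
Unset Printing Implicit Defensive.

Import GRing.Theory Num.Theory.

Local Open Scope ring_scope.

(** The operators [M i = A i B i] inherit their relations by moving the letters
    of a product past one another and counting signs: in [M i M i] and in
    [M i M (i+1)] exactly one anticommuting pair is exchanged, for distant
    indices none is.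

    If [a] and [b] anticommute and both square to [-1], then [a b a = b], so
    [(1 + a)(1 + b)(1 + a) = 2 (a + b)], which is symmetric in [a] and [b];
    scaling by any constant preserves this braid relation
    ([anticomm_braid]). Also [(1 + a)(1 - a) = 2], so [c (1 + a)] and
    [c (1 - a)] are inverse to one another as soon as [2 c ^ 2 = 1]
    ([braid_opK]). Finally, the braid group has the expected universal
    property: invertible operators that satisfy the braid relations
    extend to a representation ([braid_representation]), because evaluation of
    words is constant on the classes of the braid congruence. *)

Section BraidRepresentation.
Variables (C : nzRingType) (V : lmodType C) (n : nat).
Variables s t : 'I_n.-1 -> {linear V -> V}.

(** The operator attached to a letter; [t i] plays the role of the inverse
    of [s i]. *)
Definition letter_op (l : 'I_n.-1 * bool) : {linear V -> V} :=
  if l.2 then s l.1 else t l.1.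

(** The operator attached to a word: the first letter is applied last. *)
Fixpoint word_op (u : braid_word n) : {linear V -> V} :=
  if u is l :: u' then letter_op l \o word_op u' else idfun.

Lemma word_op_cat u v x : word_op (u ++ v) x = word_op u (word_op v x).
Proof. by elim: u => //= l u ->. Qed.

Hypothesis sK : forall i, cancel (s i) (t i).
Hypothesis tK : forall i, cancel (t i) (s i).
Hypothesis s_comm : forall i j : 'I_n.-1, (1 < `|i - j|)%N ->
  s i \o s j =1 s j \o s i.
Hypothesis s_braid : forall i j : 'I_n.-1, j = i.+1 :> nat ->
  s i \o s j \o s i =1 s j \o s i \o s j.

Lemma word_op_cong u v : braid_cong u v -> word_op u =1 word_op v.
Proof.
elim=> {u v} [u|u v _ uv|u v w _ uv _ vw|u u' v v' _ uu _ vv|i b|i j ij|i j ij] x.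
- by [].
- by rewrite uv.
- by rewrite uv vw.
- by rewrite !word_op_cat uu vv.
- by case: b; rewrite /= /letter_op /= ?sK ?tK.
- exact: s_comm.
- exact: s_braid.
Qed.

(** The representation evaluates the canonical representative word of a group
    element. *)
Lemma braid_representation :
  exists rho : braid_group n -> {linear V -> V},
    group_representation rho /\ forall i, rho (braid_gen i) =1 s i.
Proof.
pose rho (g : braid_group n) := word_op (repr g).
have rho_class u : rho (braid_class u) =1 word_op u.
  exact/word_op_cong/braid_repr_class.
have rho1 : rho 1%g =1 idfun by move=> x; rewrite rho_class.
have rhoM g h : rho (g * h)%g =1 rho g \o rho h.
  by move=> x; rewrite rho_class word_op_cat.
exists rho; split; last by move=> i x; rewrite rho_class.
split=> // g; exists (rho g^-1%g) => x.
- by have := rhoM g^-1%g g x; rewrite mulVg rho1.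
- by have := rhoM g g^-1%g x; rewrite mulgV rho1.
Qed.

End BraidRepresentation.

Section BraidOperator.
Variables (C : comNzRingType) (V : lmodType C) (c : C).

(** The operator [c (1 + a)]. *)
Definition braid_op (a : {linear V -> V}) : {linear V -> V} :=
  c \*: (idfun \+ a).

(** The operator [c (1 - a)]. *)
Definition braid_opV (a : {linear V -> V}) : {linear V -> V} :=
  c \*: (idfun \- a).

Lemma braid_opK (a : {linear V -> V}) : c * c *+ 2 = 1 ->
  a \o a =1 \- idfun ->
  cancel (braid_op a) (braid_opV a) /\ cancel (braid_opV a) (braid_op a).
Proof.
move=> c2 aa; have aE x : a (a x) = - x := aa x.
have halve (x : V) : c *: (c *: (x + x)) = x.
  by rewrite scalerA -mulr2n -scaler_nat scalerA mulr_natr c2 scale1r.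
split=> x; rewrite /braid_op /braid_opV /= [a (c *: _)]linearZ /=.
  by rewrite -scalerBr [a _]linearD aE opprD opprK addrA addrK halve.
by rewrite -scalerDr [a _]linearB aE opprK addrA subrK halve.
Qed.

Lemma comm_braid_op (a b : {linear V -> V}) : a \o b =1 b \o a ->
  braid_op a \o braid_op b =1 braid_op b \o braid_op a.
Proof.
move=> ab x; have abE : a (b x) = b (a x) := ab x.
rewrite /braid_op /= [a _]linearZ [b (c *: _)]linearZ /= -!scalerDr.
by rewrite !linearD /= abE addrACA.
Qed.

(** As [a b a = b], the product is [2 c ^ 3 (a + b)]; only the square of [a]
    matters here. *)
Lemma anticomm_braid_opE (a b : {linear V -> V}) x :
  a \o a =1 \- idfun -> a \o b =1 \- (b \o a) ->
  braid_op a (braid_op b (braid_op a x)) =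
  c *: (c *: (c *: ((a x + b x) *+ 2))).
Proof.
move=> aa ab.
have aE y : a (a y) = - y := aa y.
have abE y : a (b y) = - b (a y) := ab y.
rewrite /braid_op /= !(linearZ, linearD) /= !(linearZ, linearD) /=.
rewrite -!(scalerDr c).
do 3 congr (_ *: _).
rewrite !abE !aE linearN opprK.
rewrite addrACA (addrC x) [a x + x + _]addrACA subrr addr0.
by rewrite [b x + _ + _]addrA addrK addrACA.
Qed.

Lemma anticomm_braid (a b : {linear V -> V}) :
  a \o a =1 \- idfun -> b \o b =1 \- idfun -> a \o b =1 \- (b \o a) ->
  braid_op a \o braid_op b \o braid_op a =1
  braid_op b \o braid_op a \o braid_op b.
Proof.
move=> aa bb ab x.
have ba : b \o a =1 \- (a \o b).
  by move=> y; rewrite /= (ab y : a (b y) = - b (a y)) opprK.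
rewrite -[LHS]/(braid_op a (braid_op b (braid_op a x))).
rewrite -[RHS]/(braid_op b (braid_op a (braid_op b x))).
by rewrite !anticomm_braid_opE // addrC.
Qed.

End BraidOperator.

Lemma majorana_extraspecial (C : nzRingType) (V : lmodType C) (n : nat)
    (A B : 'I_n -> {linear V -> V}) :
  majorana_string A B ->
  extraspecial_2group (fun i => A i \o B i : {linear V -> V}).
Proof.
move=> [AA [BB [AB [ABS [ASB [ABd [AAc BBc]]]]]]].
have AAE i x : A i (A i x) = x := AA i x.
have BBE i x : B i (B i x) = x := BB i x.
have BAE i x : B i (A i x) = - A i (B i x).
  by apply: oppr_inj; rewrite opprK -[RHS]/((A i \o B i) x) AB.
split; [|split].
- by move=> i x; rewrite /= BAE linearN /= AAE BBE.
- move=> i j ij x /=.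
  have ABE y : A i (B j y) = - B j (A i y) := ABS i j ij y.
  have ABE' y : A j (B i y) = B i (A j y) := ASB i j ij y.
  have AcE y : A i (A j y) = A j (A i y) := AAc i j y.
  have BcE y : B i (B j y) = B j (B i y) := BBc i j y.
  by rewrite -ABE' AcE BcE ABE linearN.
- move=> i j ij x /=.
  have ji : (1 < `|j - i|)%N by rewrite distnC.
  have ABE y : A i (B j y) = B j (A i y) := ABd i j ij y.
  have ABE' y : A j (B i y) = B i (A j y) := ABd j i ji y.
  have AcE y : A i (A j y) = A j (A i y) := AAc i j y.
  have BcE y : B i (B j y) = B j (B i y) := BBc i j y.
  by rewrite -ABE' AcE BcE ABE.
Qed.

Theorem mainTheorem3 (R : realType) (V : lmodType R[i]) (n : nat)
    (A B : 'I_n -> {linear V -> V}) (hAB : majorana_string A B) :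
  let M (i : 'I_n) : {linear V -> V} := A i \o B i in
  let sigma (i : 'I_n.-1) : {linear V -> V} :=
    (sqrtC (2 : R[i]))^-1 \*: (idfun \+ M (widen_ord (leq_pred n) i)) in
  extraspecial_2group M /\
  (forall i, bijective (sigma i)) /\
  exists rho : braid_group n -> {linear V -> V},
    group_representation rho /\
    forall i, rho (braid_gen i) =1 sigma i.
Proof.
move=> M sigma.
have hM : extraspecial_2group M := majorana_extraspecial hAB.
have [MM [Manti Mcomm]] := hM.
pose c := (sqrtC (2 : R[i]))^-1.
have c2 : c * c *+ 2 = 1.
  by rewrite -expr2 exprVn sqrtCK -[LHS]mulr_natr mulVf // pnatr_eq0.
pose m i := M (widen_ord (leq_pred n) i).
pose tau i := braid_opV c (m i).
have sK i : cancel (sigma i) (tau i).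
  by case: (braid_opK c2 (MM (widen_ord (leq_pred n) i))).
have tK i : cancel (tau i) (sigma i).
  by case: (braid_opK c2 (MM (widen_ord (leq_pred n) i))).
split=> //; split; first by move=> i; exists (tau i).
apply: (braid_representation sK tK) => i j ij.
- exact/comm_braid_op/Mcomm.
- exact/anticomm_braid/Manti.
Qed.
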